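(* Let $A_1,A_2,A_3,A_4$, $B_1,B_2,B_3,B_4$ and $B$ be matrices over $\mathbb{H}$ of sizes such that the equation $$A_{1}X_{1}+X_{2}B_{1}+A_{2}Y_{1}B_{2}+A_{3}Y_{2}B_{3}+A_{4}Y_{3}B_{4}=B \qquad (\star)$$ in the unknown quaternion matrices $X_1,X_2,Y_1,Y_2,Y_3$ makes sense, and suppose $(\star)$ is solvable. With the auxiliary matrices defined in the context, the general solution to $(\star)$ can be expressed as $$X_1=A_1^\dagger(B-A_2Y_1B_2-A_3Y_2B_3-A_4Y_3B_4)-A_1^\dagger U_1B_1+L_{A_1}U_2,$$ $$X_2=R_{A_1}(B-A_2Y_1B_2-A_3Y_2B_3-A_4Y_3B_4)B_1^\dagger+A_1A_1^\dagger U_1+U_3R_{B_1},$$ $$Y_1=A_{11}^\dagger TB_{11}^\dagger-A_{11}^\dagger A_{22}M_1^\dagger TB_{11}^\dagger-A_{11}^\dagger S_1A_{22}^\dagger TN_1^\dagger B_{22}B_{11}^\dagger-A_{11}^\dagger S_1U_4R_{N_1}B_{22}B_{11}^\dagger+L_{A_{11}}U_5+U_6R_{B_{11}},$$ $$Y_2=M_1^\dagger TB_{22}^\dagger+S_1^\dagger S_1A_{22}^\dagger TN_1^\dagger+L_{M_1}L_{S_1}U_7+U_8R_{B_{22}}+L_{M_1}U_4R_{N_1},$$ $$Y_3=F_1+L_{C_2}V_1+V_2R_{D_1}+L_{C_1}V_3R_{D_2},\quad\text{or}\quad Y_3=F_2-L_{C_4}W_1-W_2R_{D_3}-L_{C_3}W_3R_{D_4},$$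 where $T=T_1-A_{33}Y_3B_{33}$, $U_1,\dots,U_8$ are arbitrary matrices of appropriate sizes over $\mathbb{H}$, and $$V_1=(I_m,\,0)\left[C_{11}^\dagger(F-C_{22}V_3D_{22}-C_{33}W_3D_{33})-C_{11}^\dagger U_{11}D_{11}+L_{C_{11}}U_{12}\right],$$ $$W_1=(0,\,I_m)\left[C_{11}^\dagger(F-C_{22}V_3D_{22}-C_{33}W_3D_{33})-C_{11}^\dagger U_{11}D_{11}+L_{C_{11}}U_{12}\right],$$ $$W_2=\left[R_{C_{11}}(F-C_{22}V_3D_{22}-C_{33}W_3D_{33})D_{11}^\dagger+C_{11}C_{11}^\dagger U_{11}+U_{21}R_{D_{11}}\right]\begin{pmatrix} 0\\ I_n\end{pmatrix},$$ $$V_2=\left[R_{C_{11}}(F-C_{22}V_3D_{22}-C_{33}W_3D_{33})D_{11}^\dagger+C_{11}C_{11}^\dagger U_{11}+U_{21}R_{D_{11}}\right]\begin{pmatrix} I_n\\ 0\end{pmatrix},$$ $$V_3=E_{11}^\dagger FE_{33}^\dagger-E_{11}^\dagger E_{22}M^\dagger FE_{33}^\dagger-E_{11}^\dagger SE_{22}^\dagger FN^\dagger E_{44}E_{33}^\dagger-E_{11}^\dagger SU_{31}R_NE_{44}E_{33}^\dagger+L_{E_{11}}U_{32}+U_{33}R_{E_{33}},$$ $$W_3=M^\dagger FE_{44}^\dagger+S^\dagger SE_{22}^\dagger FN^\dagger+L_ML_SU_{41}+L_MU_{31}R_N-U_{42}R_{E_{44}},$$ with $U_{11},U_{12},U_{21},U_{31},U_{32},U_{33},U_{41},U_{42}$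 arbitrary matrices of appropriate sizes over $\mathbb{H}$, $m$ the number of columns of $A_4$ and $n$ the number of rows of $B_4$.
   Context: ''The general solution can be expressed as'' means: for every choice of the arbitrary matrices the resulting tuple is a solution, and every solution arises from some such choice. $\mathbb{H}$ is the Hamilton quaternion algebra over $\mathbb{R}$. For a quaternion matrix $A$, $A^*$ is its conjugate transpose and $A^\dagger$ its Moore--Penrose inverse, i.e. the unique $Y$ with $AYA=A$, $YAY=Y$, $(AY)^*=AY$, $(YA)^*=YA$. Put $L_A=I-A^\dagger A$ and $R_A=I-AA^\dagger$. $I$ (or $I_k$) and $0$ denote identity and zero matrices of appropriate sizes; $(P,Q)$ denotes the block row matrix. Definitions, given $A_1,\dots,A_4,B_1,\dots,B_4,B$: $A_{11}=R_{A_1}A_2$, $A_{22}=R_{A_1}A_3$, $A_{33}=R_{A_1}A_4$, $B_{11}=B_2L_{B_1}$, $B_{22}=B_3L_{B_1}$, $B_{33}=B_4L_{B_1}$, $N_1=B_{22}L_{B_{11}}$, $M_1=R_{A_{11}}A_{22}$, $S_1=A_{22}L_{M_1}$, $T_1=R_{A_1}BL_{B_1}$; $C=R_{M_1}R_{A_{11}}$, $C_1=CA_{33}$, $C_2=R_{A_{11}}A_{33}$, $C_3=R_{A_{22}}A_{33}$, $C_4=A_{33}$; $D=L_{B_{11}}L_{N_1}$, $D_1=B_{33}$, $D_2=B_{33}L_{B_{22}}$, $D_3=B_{33}L_{B_{11}}$, $D_4=B_{33}D$; $E_1=CT_1$, $E_2=R_{A_{11}}T_1L_{B_{22}}$, $E_3=R_{A_{22}}T_1L_{B_{11}}$,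 $E_4=T_1D$; $C_{11}=(L_{C_2},\,L_{C_4})$, $D_{11}=\begin{pmatrix} R_{D_1}\\ R_{D_3}\end{pmatrix}$, $C_{22}=L_{C_1}$, $D_{22}=R_{D_2}$, $C_{33}=L_{C_3}$, $D_{33}=R_{D_4}$; $E_{11}=R_{C_{11}}C_{22}$, $E_{22}=R_{C_{11}}C_{33}$, $E_{33}=D_{22}L_{D_{11}}$, $E_{44}=D_{33}L_{D_{11}}$, $M=R_{E_{11}}E_{22}$, $N=E_{44}L_{E_{33}}$, $S=E_{22}L_M$; $F_1=C_1^\dagger E_1D_1^\dagger+L_{C_1}C_2^\dagger E_2D_2^\dagger$, $F_2=C_3^\dagger E_3D_3^\dagger+L_{C_3}C_4^\dagger E_4D_4^\dagger$, $F=F_2-F_1$. *)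

(* Defs.v *)
From HB Require Import structures.
From mathcomp Require Import all_boot all_order all_algebra.
From mathcomp Require Import boolp classical_sets reals ring.

Set Implicit Arguments.
Unset Strict Implicit.
Unset Printing Implicit Defensive.

Import GRing.Theory.
Local Open Scope ring_scope.

(* [Quat a b c d] is the quaternion a + b i + c j + d k. *)
Record quat (R : realType) : Type :=
  Quat { qre : R ; qi : R ; qj : R ; qk : R }.

Definition quat_tuple (R : realType) (x : quat R) : R * R * R * R :=
  (qre x, qi x, qj x, qk x).
Definition tuple_quat (R : realType) (t : R * R * R * R) : quat R :=
  let: (a, b, c, d) := t in Quat a b c d.

Lemma quat_tupleK (R : realType) : cancel (@quat_tuple R) (@tuple_quat R).
Proof. by case. Qed.

HB.instance Definition _ (R : realType) :=
  Choice.copy (quat R) (can_type (@quat_tupleK R)).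

Definition addq (R : realType) (x y : quat R) : quat R :=
  Quat (qre x + qre y) (qi x + qi y) (qj x + qj y) (qk x + qk y).
Definition oppq (R : realType) (x : quat R) : quat R :=
  Quat (- qre x) (- qi x) (- qj x) (- qk x).
Definition mulq (R : realType) (x y : quat R) : quat R :=
  Quat (qre x * qre y - qi x * qi y - qj x * qj y - qk x * qk y)
       (qre x * qi y + qi x * qre y + qj x * qk y - qk x * qj y)
       (qre x * qj y - qi x * qk y + qj x * qre y + qk x * qi y)
       (qre x * qk y + qi x * qj y - qj x * qi y + qk x * qre y).
Definition conjq (R : realType) (x : quat R) : quat R :=
  Quat (qre x) (- qi x) (- qj x) (- qk x).

Section QuatRing.
Context {R : realType}.
Implicit Types x y z : quat R.

Local Notation q0 := (Quat 0 0 0 0 : quat R).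
Local Notation q1 := (Quat 1 0 0 0 : quat R).

Lemma addqA : associative (@addq R).
Proof. by move=> x y z; congr Quat; rewrite /= addrA. Qed.
Lemma addqC : commutative (@addq R).
Proof. by move=> x y; congr Quat; rewrite /= addrC. Qed.
Lemma add0q : left_id q0 (@addq R).
Proof. by case=> a b c d; congr Quat; rewrite /= add0r. Qed.
Lemma addNq : left_inverse q0 (@oppq R) (@addq R).
Proof. by move=> x; congr Quat; rewrite /= addNr. Qed.

HB.instance Definition _ := GRing.isZmodule.Build (quat R) addqA addqC add0q addNq.

Lemma mulqA : associative (@mulq R).
Proof. by move=> x y z; congr Quat => /=; ring. Qed.
Lemma mul1q : left_id q1 (@mulq R).
Proof. by case=> a b c d; congr Quat => /=; ring. Qed.
Lemma mulq1 : right_id q1 (@mulq R).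
Proof. by case=> a b c d; congr Quat => /=; ring. Qed.
Lemma mulqDl : left_distributive (@mulq R) (@addq R).
Proof. by move=> x y z; congr Quat => /=; ring. Qed.
Lemma mulqDr : right_distributive (@mulq R) (@addq R).
Proof. by move=> x y z; congr Quat => /=; ring. Qed.
Lemma q1_neq0 : q1 != 0.
Proof. by apply/eqP => -[/eqP]; rewrite oner_eq0. Qed.

HB.instance Definition _ :=
  GRing.Zmodule_isNzRing.Build (quat R) mulqA mul1q mulq1 mulqDl mulqDr q1_neq0.

End QuatRing.

Definition ctrmx (R : realType) (m n : nat) (A : 'M[quat R]_(m, n)) :
    'M[quat R]_(n, m) :=
  (map_mx (@conjq R) A)^T.

Definition penrose (R : realType) (m n : nat) (A : 'M[quat R]_(m, n))
    (Y : 'M[quat R]_(n, m)) : Prop :=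
  [/\ A *m Y *m A = A, Y *m A *m Y = Y,
      ctrmx (A *m Y) = A *m Y & ctrmx (Y *m A) = Y *m A].

(* The matrix Y such that [penrose A Y]; the default value 0 of [xget] is only
   there to make the definition total. *)
Definition mpinv (R : realType) (m n : nat) (A : 'M[quat R]_(m, n)) :
    'M[quat R]_(n, m) :=
  xget 0 [set Y | penrose A Y]%classic.

Notation "A ^dag" := (mpinv A) (at level 8, format "A ^dag") : ring_scope.

Definition Lmx (R : realType) (m n : nat) (A : 'M[quat R]_(m, n)) : 'M[quat R]_n :=
  1%:M - A^dag *m A.
Definition Rmx (R : realType) (m n : nat) (A : 'M[quat R]_(m, n)) : 'M[quat R]_m :=
  1%:M - A *m A^dag.

(* The equation A1 X1 + X2 B1 + A2 Y1 B2 + A3 Y2 B3 + A4 Y3 B4 = B. The module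
   is not imported, so that its one-letter names do not leak. *)
Module Sylv.
Section Sylv.
Context {R : realType} {p q a1 b1 a2 b2 a3 b3 m n : nat}.
Context (A1 : 'M[quat R]_(p, a1)) (A2 : 'M[quat R]_(p, a2))
        (A3 : 'M[quat R]_(p, a3)) (A4 : 'M[quat R]_(p, m))
        (B1 : 'M[quat R]_(b1, q)) (B2 : 'M[quat R]_(b2, q))
        (B3 : 'M[quat R]_(b3, q)) (B4 : 'M[quat R]_(n, q))
        (B : 'M[quat R]_(p, q)).

Definition A11 := Rmx A1 *m A2.
Definition A22 := Rmx A1 *m A3.
Definition A33 := Rmx A1 *m A4.
Definition B11 := B2 *m Lmx B1.
Definition B22 := B3 *m Lmx B1.
Definition B33 := B4 *m Lmx B1.
Definition N1 := B22 *m Lmx B11.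
Definition M1 := Rmx A11 *m A22.
Definition S1 := A22 *m Lmx M1.
Definition T1 := Rmx A1 *m B *m Lmx B1.

Definition C := Rmx M1 *m Rmx A11.
Definition C1 := C *m A33.
Definition C2 := Rmx A11 *m A33.
Definition C3 := Rmx A22 *m A33.
Definition C4 := A33.

Definition D := Lmx B11 *m Lmx N1.
Definition D1 := B33.
Definition D2 := B33 *m Lmx B22.
Definition D3 := B33 *m Lmx B11.
Definition D4 := B33 *m D.

Definition E1 := C *m T1.
Definition E2 := Rmx A11 *m T1 *m Lmx B22.
Definition E3 := Rmx A22 *m T1 *m Lmx B11.
Definition E4 := T1 *m D.

Definition C11 := row_mx (Lmx C2) (Lmx C4).
Definition D11 := col_mx (Rmx D1) (Rmx D3).
Definition C22 := Lmx C1.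
Definition D22 := Rmx D2.
Definition C33 := Lmx C3.
Definition D33 := Rmx D4.

Definition E11 := Rmx C11 *m C22.
Definition E22 := Rmx C11 *m C33.
Definition E33 := D22 *m Lmx D11.
Definition E44 := D33 *m Lmx D11.
Definition M := Rmx E11 *m E22.
Definition N := E44 *m Lmx E33.
Definition S := E22 *m Lmx M.

Definition F1 := C1^dag *m E1 *m D1^dag + Lmx C1 *m C2^dag *m E2 *m D2^dag.
Definition F2 := C3^dag *m E3 *m D3^dag + Lmx C3 *m C4^dag *m E4 *m D4^dag.
Definition F := F2 - F1.

Definition solution (X1 : 'M[quat R]_(a1, q)) (X2 : 'M[quat R]_(p, b1))
    (Y1 : 'M[quat R]_(a2, b2)) (Y2 : 'M[quat R]_(a3, b3))
    (Y3 : 'M[quat R]_(m, n)) : Prop :=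
  A1 *m X1 + X2 *m B1 + A2 *m Y1 *m B2 + A3 *m Y2 *m B3 + A4 *m Y3 *m B4 = B.

Section Y3.
Context (U11 : 'M[quat R]_(m, n + n)) (U12 : 'M[quat R]_(m + m, n))
        (U21 : 'M[quat R]_(m, n + n)) (U31 U32 U33 U41 U42 : 'M[quat R]_(m, n)).

Definition V3 : 'M[quat R]_(m, n) :=
  E11^dag *m F *m E33^dag
  - E11^dag *m E22 *m M^dag *m F *m E33^dag
  - E11^dag *m S *m E22^dag *m F *m N^dag *m E44 *m E33^dag
  - E11^dag *m S *m U31 *m Rmx N *m E44 *m E33^dag
  + Lmx E11 *m U32 + U33 *m Rmx E33.

Definition W3 : 'M[quat R]_(m, n) :=
  M^dag *m F *m E44^dag
  + S^dag *m S *m E22^dag *m F *m N^dag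
  + Lmx M *m Lmx S *m U41 + Lmx M *m U31 *m Rmx N - U42 *m Rmx E44.

(* The bracketed factors common to V1, W1 and to V2, W2. *)
Definition VW1 : 'M[quat R]_(m + m, n) :=
  C11^dag *m (F - C22 *m V3 *m D22 - C33 *m W3 *m D33)
  - C11^dag *m U11 *m D11 + Lmx C11 *m U12.
Definition VW2 : 'M[quat R]_(m, n + n) :=
  Rmx C11 *m (F - C22 *m V3 *m D22 - C33 *m W3 *m D33) *m D11^dag
  + C11 *m C11^dag *m U11 + U21 *m Rmx D11.

Definition V1 : 'M[quat R]_(m, n) := row_mx 1%:M 0 *m VW1.
Definition W1 : 'M[quat R]_(m, n) := row_mx 0 1%:M *m VW1.
Definition W2 : 'M[quat R]_(m, n) := VW2 *m col_mx 0 1%:M.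
Definition V2 : 'M[quat R]_(m, n) := VW2 *m col_mx 1%:M 0.

Definition Y3V : 'M[quat R]_(m, n) :=
  F1 + Lmx C2 *m V1 + V2 *m Rmx D1 + Lmx C1 *m V3 *m Rmx D2.
Definition Y3W : 'M[quat R]_(m, n) :=
  F2 - Lmx C4 *m W1 - W2 *m Rmx D3 - Lmx C3 *m W3 *m Rmx D4.
End Y3.

Section Others.
Context (Y3 : 'M[quat R]_(m, n)).
Context (U1 : 'M[quat R]_(p, b1)) (U2 : 'M[quat R]_(a1, q))
        (U3 : 'M[quat R]_(p, b1)) (U4 : 'M[quat R]_(a3, b3))
        (U5 U6 : 'M[quat R]_(a2, b2)) (U7 U8 : 'M[quat R]_(a3, b3)).

Definition T := T1 - A33 *m Y3 *m B33.

Definition Y1 : 'M[quat R]_(a2, b2) :=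
  A11^dag *m T *m B11^dag
  - A11^dag *m A22 *m M1^dag *m T *m B11^dag
  - A11^dag *m S1 *m A22^dag *m T *m N1^dag *m B22 *m B11^dag
  - A11^dag *m S1 *m U4 *m Rmx N1 *m B22 *m B11^dag
  + Lmx A11 *m U5 + U6 *m Rmx B11.

Definition Y2 : 'M[quat R]_(a3, b3) :=
  M1^dag *m T *m B22^dag
  + S1^dag *m S1 *m A22^dag *m T *m N1^dag
  + Lmx M1 *m Lmx S1 *m U7 + U8 *m Rmx B22 + Lmx M1 *m U4 *m Rmx N1.

Definition X1 : 'M[quat R]_(a1, q) :=
  A1^dag *m (B - A2 *m Y1 *m B2 - A3 *m Y2 *m B3 - A4 *m Y3 *m B4)
  - A1^dag *m U1 *m B1 + Lmx A1 *m U2.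

Definition X2 : 'M[quat R]_(p, b1) :=
  Rmx A1 *m (B - A2 *m Y1 *m B2 - A3 *m Y2 *m B3 - A4 *m Y3 *m B4) *m B1^dag
  + A1 *m A1^dag *m U1 + U3 *m Rmx B1.

(* Primed names are the candidate tuple, unprimed ones the formulas above. *)
Definition tuple_of (X1' : 'M[quat R]_(a1, q)) (X2' : 'M[quat R]_(p, b1))
    (Y1' : 'M[quat R]_(a2, b2)) (Y2' : 'M[quat R]_(a3, b3))
    (Y3' : 'M[quat R]_(m, n)) : Prop :=
  [/\ X1' = X1, X2' = X2, Y1' = Y1, Y2' = Y2 & Y3' = Y3].
End Others.

End Sylv.
End Sylv.

(* Main.v *)
(* Multiplying by R_{A1} on the left and by L_{B1} on the right removes X1 and
   X2. For fixed Y3 what remains is A11 Y1 B11 + A22 Y2 B22 = T, which is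
   solvable iff four equations C_i Y3 D_i = E_i hold. The pairs i = 1, 2 and
   i = 3, 4 are nested (C1 is a left multiple of C2 and D2 a right multiple of
   D1; likewise for C3, C4, D4, D3), and each has the general solution F_j plus a
   homogeneous part. Equating the two descriptions of Y3 gives, for the
   parameters V_i and W_i, an equation of the same four-term shape as the one for
   X1, X2, Y1, Y2, so the same lemma solves both. *)
Require Import Defs.
From mathcomp Require Import all_boot all_order all_algebra.
From mathcomp Require Import reals.
From mathcomp Require Import classical_sets ring.

Set Implicit Arguments.
Unset Strict Implicit.
Unset Printing Implicit Defensive.

Import GRing.Theory Num.Theory.
Local Open Scope ring_scope.

Section QuatMatrix.
Context {R : realType}.
Implicit Types (m n p : nat).

(** * Quaternion conjugation and the conjugate transpose *)

Lemma conjqK : involutive (@conjq R).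
Proof. by case=> a b c d; rewrite /conjq /= !opprK. Qed.

Lemma conjqD (x y : quat R) : conjq (x + y) = conjq x + conjq y.
Proof. by congr Quat => /=; rewrite ?opprD. Qed.

Lemma conjqM (x y : quat R) : conjq (x * y) = conjq y * conjq x.
Proof. by congr Quat => /=; ring. Qed.

Lemma conjq0 : conjq 0 = 0 :> quat R.
Proof. by congr Quat => /=; rewrite ?oppr0. Qed.

Lemma conjq1 : conjq 1 = 1 :> quat R.
Proof. by congr Quat => /=; rewrite ?oppr0. Qed.

Lemma conjq_sum (I : Type) (r : seq I) (F : I -> quat R) :
  conjq (\sum_(i <- r) F i) = \sum_(i <- r) conjq (F i).
Proof. exact: (big_morph _ conjqD conjq0). Qed.

Lemma ctrmxK m n (A : 'M[quat R]_(m, n)) : ctrmx (ctrmx A) = A.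
Proof. by apply/matrixP => i j; rewrite !mxE conjqK. Qed.

Lemma ctrmxM m n p (A : 'M[quat R]_(m, n)) (B : 'M[quat R]_(n, p)) :
  ctrmx (A *m B) = ctrmx B *m ctrmx A.
Proof.
apply/matrixP => i j; rewrite !mxE conjq_sum.
by apply: eq_bigr => k _; rewrite conjqM !mxE.
Qed.

Lemma ctrmxD m n (A B : 'M[quat R]_(m, n)) :
  ctrmx (A + B) = ctrmx A + ctrmx B.
Proof. by apply/matrixP => i j; rewrite !mxE conjqD. Qed.

Lemma ctrmxN m n (A : 'M[quat R]_(m, n)) : ctrmx (- A) = - ctrmx A.
Proof. by apply/matrixP => i j; rewrite !mxE. Qed.

Lemma ctrmx0 m n : ctrmx (0 : 'M[quat R]_(m, n)) = 0.
Proof. by apply/matrixP => i j; rewrite !mxE conjq0. Qed.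

Lemma ctrmx1 n : ctrmx (1%:M : 'M[quat R]_n) = 1%:M.
Proof.
by apply/matrixP => i j; rewrite !mxE eq_sym; case: eqP => _;
  rewrite ?conjq1 ?conjq0.
Qed.

Lemma ctrmx_col_mx m n p (A : 'M[quat R]_(n, m)) (B : 'M[quat R]_(p, m)) :
  ctrmx (col_mx A B) = row_mx (ctrmx A) (ctrmx B).
Proof. by rewrite /ctrmx map_col_mx tr_col_mx. Qed.

(** * Existence of the Moore-Penrose inverse *)

Lemma conjq_mul_self (x : quat R) :
  conjq x * x = Quat (qre x ^+ 2 + qi x ^+ 2 + qj x ^+ 2 + qk x ^+ 2) 0 0 0.
Proof. by congr Quat => /=; ring. Qed.

(** The single entry of [c^* c] is the sum of the squared norms of the entries of [c], a positive
    real. Its inverse is real too, hence self-adjoint, and noncommutativity does no harm. *)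
Lemma gram_inv m (c : 'cV[quat R]_m) : c != 0 ->
  exists k : 'M[quat R]_1,
    k *m (ctrmx c *m c) = 1%:M /\ ctrmx k = k.
Proof.
move=> c0.
pose s (x : quat R) := qre x ^+ 2 + qi x ^+ 2 + qj x ^+ 2 + qk x ^+ 2.
have s_ge0 x : 0 <= s x by rewrite /s !addr_ge0 ?sqr_ge0.
pose t := \sum_i s (c i 0).
have gramE : ctrmx c *m c = (Quat t 0 0 0)%:M.
  apply/matrixP => i j; rewrite !ord1 !mxE eqxx mulr1n.
  under eq_bigr => k _ do rewrite !mxE conjq_mul_self.
  have addE (a b : R) : Quat (a + b) 0 0 0 = Quat a 0 0 0 + Quat b 0 0 0.
    by congr Quat; rewrite /= addr0.
  by rewrite /t (big_morph (fun a => Quat a 0 0 0) addE (erefl _)).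
have t0 : t != 0.
  apply: contraNneq c0 => /eqP; rewrite psumr_eq0 // => /allP t0.
  apply/eqP/matrixP => i j; rewrite ord1 mxE.
  have /(_ (mem_index_enum i)) := t0 i; rewrite /s.
  rewrite !paddr_eq0 ?addr_ge0 ?sqr_ge0 // !sqrf_eq0.
  by case: (c i 0) => a b e f /= /andP[/andP[/andP[/eqP-> /eqP->] /eqP->] /eqP->].
have realM (a b : R) : Quat a 0 0 0 * Quat b 0 0 0 = Quat (a * b) 0 0 0.
  by congr Quat => /=; ring.
exists (Quat t^-1 0 0 0)%:M; split.
- by rewrite gramE -scalar_mxM realM mulVf.
- apply/matrixP => i j; rewrite !ord1 !mxE eqxx !mulr1n.
  by rewrite /conjq /= !oppr0.
Qed.

(* Greville's recursion on the columns: with [d = A^dag a] and [c = a - A d],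
   the inverse of [(A, a)] is [(A^dag - d b; b)], where [b] is the inverse of
   [c] if [c != 0] and [(1 + d^* d)^-1 d^* A^dag] otherwise. *)
Lemma penrose_exists m n (A : 'M[quat R]_(m, n)) : exists Y, penrose A Y.
Proof.
elim: n A => [|n IHn].
  move=> A; exists 0; split; rewrite ?mulmx0 ?mul0mx ?ctrmx0 //.
  by apply/matrixP => i [].
rewrite -addn1 => A0; rewrite -[A0]hsubmxK.
move: (lsubmx A0) (rsubmx A0) => A a {A0}.
have [Z [AZA ZAZ AZ ZA]] := IHn A.
have [d ZaE] : exists d, Z *m a = d by exists (Z *m a).
pose c := a - A *m d.
have ZAd : Z *m A *m d = d by rewrite -ZaE mulmxA ZAZ.
have aE : a = A *m d + c by rewrite addrC subrK.
have AZc : A *m Z *m c = 0.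
  by rewrite /c mulmxBr !mulmxA AZA -mulmxA ZaE subrr.
have cA : ctrmx c *m A = 0.
  have : ctrmx (A *m Z *m c) = 0 by rewrite AZc ctrmx0.
  by rewrite ctrmxM AZ => cAZ; rewrite -AZA mulmxA cAZ mul0mx.
(* These conditions on the new row [b] imply the four Penrose equations for [(A, a)], so the cases
   [c = 0] and [c != 0] only have to supply [b]. *)
suff [b [hb1 hb2 hb3 hb4]] : exists b : 'M[quat R]_(1, m),
    [/\ (A *m Z + c *m b) *m A = A /\ (A *m Z + c *m b) *m a = a,
        b *m (A *m Z + c *m b) = b,
        ctrmx (c *m b) = c *m b &
        [/\ ctrmx (d *m b *m A) = d *m b *m A, ctrmx (b *m A) = d - d *m b *m a
          & ctrmx (b *m a) = b *m a]].
  have XY : row_mx A a *m col_mx (Z - d *m b) b = A *m Z + c *m b.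
    by rewrite mul_row_col mulmxBr /c mulmxBl mulmxA addrAC addrA.
  have YX : col_mx (Z - d *m b) b *m row_mx A a =
      block_mx (Z *m A - d *m b *m A) (d - d *m b *m a) (b *m A) (b *m a).
    by rewrite mul_col_row !mulmxBl ZaE.
  case: hb1 => hA ha; case: hb4 => h1 h2 h3.
  exists (col_mx (Z - d *m b) b); split.
  - by rewrite XY mul_mx_row hA ha.
  - rewrite -mulmxA XY mul_col_mx hb2 mulmxBl -[d *m b *m _]mulmxA hb2.
    congr col_mx; congr (_ - _).
    have Zc : Z *m c = 0 by rewrite -ZAZ -!mulmxA [A *m _]mulmxA AZc mulmx0.
    by rewrite mulmxDr !mulmxA ZAZ Zc mul0mx addr0.
  - by rewrite XY ctrmxD AZ hb3.
  - rewrite YX; rewrite /ctrmx map_block_mx tr_block_mx -!/(ctrmx _).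
    by rewrite ctrmxD ctrmxN ZA h1 h2 h3 -h2 ctrmxK.
have [c0|c0] := eqVneq c 0.
  have aE0 : a = A *m d by rewrite {1}aE c0 addr0.
  (* The Gram matrix of the column [(1; d)] is [1 + d^* d]; the entry 1 makes the column nonzero for
     every [d]. *)
  have [|k [k1 k2]] := @gram_inv _ (col_mx 1%:M d).
    apply/eqP => /matrixP /(_ (lshift n 0) 0)/eqP.
    by rewrite col_mxEu !mxE eqxx oner_eq0.
  have kd : k *m ctrmx d *m d = 1%:M - k.
    apply/eqP; rewrite -k1 ctrmx_col_mx mul_row_col ctrmx1 mul1mx mulmxDr mulmx1.
    by rewrite addrAC subrr add0r mulmxA.
  have dZA : ctrmx d *m Z *m A = ctrmx d.
    by rewrite -mulmxA -ZA -ctrmxM ZAd.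
  exists (k *m ctrmx d *m Z); rewrite c0 mul0mx addr0 AZA ctrmx0.
  split=> //; first by split; rewrite // aE0 mulmxA AZA.
    by rewrite -!mulmxA [Z *m _]mulmxA ZAZ.
  have bA : k *m ctrmx d *m Z *m A = k *m ctrmx d.
    by rewrite -!mulmxA [ctrmx d *m _]mulmxA dZA.
  have ba : k *m ctrmx d *m Z *m a = 1%:M - k by rewrite -mulmxA ZaE kd.
  split.
  - by rewrite -mulmxA bA !ctrmxM ctrmxK k2 mulmxA.
  - by rewrite bA -[d *m _ *m a]mulmxA ba ctrmxM ctrmxK k2 mulmxBr mulmx1 subKr.
  - by rewrite ba ctrmxD ctrmxN ctrmx1 k2.
(* Here [b = k c^*] is a left inverse of [c]; since [c^* A = 0], it kills [A] and sends [a] to 1. *)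
have [k [k1 k2]] := gram_inv c0.
have bA : k *m ctrmx c *m A = 0 by rewrite -mulmxA cA mulmx0.
have bc : k *m ctrmx c *m c = 1%:M by rewrite -mulmxA.
have ba : k *m ctrmx c *m a = 1%:M by rewrite {1}aE mulmxDr mulmxA bA mul0mx add0r.
exists (k *m ctrmx c); split.
- split; rewrite mulmxDl -[c *m _ *m _]mulmxA ?bA ?ba ?AZA ?mulmx0 ?addr0 //.
  by rewrite -mulmxA ZaE mulmx1 -aE.
- by rewrite mulmxDr mulmxA bA mul0mx add0r mulmxA bc mul1mx.
- by rewrite !ctrmxM ctrmxK k2 mulmxA.
- by rewrite -!mulmxA !(mulmxA k) bA ba mulmx0 !ctrmx0 mulmx1 subrr ctrmx1.
Qed.

Lemma mpinvP m n (A : 'M[quat R]_(m, n)) : penrose A A^dag.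
Proof. by have [Y AY] := penrose_exists A; exact: (xgetPex 0 (ex_intro _ Y AY)). Qed.

Lemma mulmx_dagK m n (A : 'M[quat R]_(m, n)) : A *m A^dag *m A = A.
Proof. by have [] := mpinvP A. Qed.

(** * The projections attached to a dagger, and the equations solved with them *)

Section Projections.
(* [lp] and [rp] are [Lmx] and [Rmx], kept abstract because the distributivity
   lemmas would otherwise unfold them. *)
Context (lp : forall m n, 'M[quat R]_(m, n) -> 'M[quat R]_n)
        (rp : forall m n, 'M[quat R]_(m, n) -> 'M[quat R]_m).
Hypotheses (lpE : forall m n (A : 'M_(m, n)), lp A = 1%:M - A^dag *m A)
           (rpE : forall m n (A : 'M_(m, n)), rp A = 1%:M - A *m A^dag).

Lemma ctrmx_rp m n (A : 'M[quat R]_(m, n)) : ctrmx (rp A) = rp A.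
Proof. by have [_ _ h _] := mpinvP A; rewrite rpE ctrmxD ctrmxN ctrmx1 h. Qed.

Lemma ctrmx_lp m n (A : 'M[quat R]_(m, n)) : ctrmx (lp A) = lp A.
Proof. by have [_ _ _ h] := mpinvP A; rewrite lpE ctrmxD ctrmxN ctrmx1 h. Qed.

Lemma rp_mulmx m n (A : 'M[quat R]_(m, n)) : rp A *m A = 0.
Proof. by rewrite rpE mulmxBl mul1mx mulmx_dagK subrr. Qed.

Lemma mulmx_lp m n (A : 'M[quat R]_(m, n)) : A *m lp A = 0.
Proof. by rewrite lpE mulmxBr mulmx1 mulmxA mulmx_dagK subrr. Qed.

Lemma rp_idem m n (A : 'M[quat R]_(m, n)) : rp A *m rp A = rp A.
Proof. by rewrite [X in _ *m X]rpE mulmxBr mulmx1 mulmxA rp_mulmx mul0mx subr0. Qed.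

Lemma lp_idem m n (A : 'M[quat R]_(m, n)) : lp A *m lp A = lp A.
Proof. by rewrite [X in X *m _]lpE mulmxBl mul1mx -mulmxA mulmx_lp mulmx0 subr0. Qed.

(** Since [A A^dag] is self-adjoint, taking adjoints turns [P A A^dag = A A^dag] into
    [A A^dag P = A A^dag]; multiply by [A^dag] on the left. *)
Lemma dag_absorbl m n (P : 'M[quat R]_m) (A : 'M[quat R]_(m, n)) :
  ctrmx P = P -> P *m A = A -> A^dag *m P = A^dag.
Proof.
move=> hP PA; have [_ ZAZ hA _] := mpinvP A.
rewrite -{1}ZAZ -!mulmxA [A *m _]mulmxA -[A *m _ in LHS]hA -{1}hP -ctrmxM.
by rewrite !mulmxA PA hA mulmxA ZAZ.
Qed.

Lemma dag_absorbr m n (P : 'M[quat R]_n) (A : 'M[quat R]_(m, n)) :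
  ctrmx P = P -> A *m P = A -> P *m A^dag = A^dag.
Proof.
move=> hP AP; have [_ ZAZ _ hA] := mpinvP A.
by rewrite -{1}ZAZ mulmxA -[A^dag *m A in LHS]hA -{1}hP -ctrmxM -mulmxA AP hA ZAZ.
Qed.

Lemma dag_mul_rp m n p (A : 'M[quat R]_(m, n)) (B : 'M[quat R]_(m, p)) :
  (rp A *m B)^dag *m rp A = (rp A *m B)^dag.
Proof. by apply: dag_absorbl; rewrite ?ctrmx_rp // mulmxA rp_idem. Qed.

Lemma lp_mul_dag m n p (A : 'M[quat R]_(m, n)) (B : 'M[quat R]_(p, n)) :
  lp A *m (B *m lp A)^dag = (B *m lp A)^dag.
Proof. by apply: dag_absorbr; rewrite ?ctrmx_lp // -mulmxA lp_idem. Qed.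

Lemma rp_mul_eq0 m n p (A : 'M[quat R]_(m, n)) (X : 'M[quat R]_(m, p)) :
  rp A *m X = 0 -> A *m A^dag *m X = X.
Proof. by rewrite rpE mulmxBl mul1mx => /eqP; rewrite subr_eq0 => /eqP <-. Qed.

Lemma mul_lp_eq0 m n p (A : 'M[quat R]_(m, n)) (X : 'M[quat R]_(p, n)) :
  X *m lp A = 0 -> X *m A^dag *m A = X.
Proof.
by rewrite lpE mulmxBr mulmx1 mulmxA => /eqP; rewrite subr_eq0 => /eqP <-.
Qed.

(** Serves to rewrite a known product in the middle of a left-associated chain. *)
Lemma mulmx_eqA m n p q (A : 'M[quat R]_(m, n)) (B : 'M_(n, p)) (C : 'M_(m, p)) :
  A *m B = C -> forall X : 'M_(q, m), X *m A *m B = X *m C.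
Proof. by move=> <- X; rewrite mulmxA. Qed.

(** * The equation [A X + Y B = E] *)

Lemma mulmx_pair_sound p q a b (A : 'M[quat R]_(p, a)) (B : 'M[quat R]_(b, q))
    (E : 'M[quat R]_(p, q)) (U1 U3 : 'M_(p, b)) (U2 : 'M_(a, q)) :
  rp A *m E *m lp B = 0 ->
  A *m (A^dag *m E - A^dag *m U1 *m B + lp A *m U2)
  + (rp A *m E *m B^dag + A *m A^dag *m U1 + U3 *m rp B) *m B = E.
Proof.
(* The [U1] terms cancel and those in [U2], [U3] vanish. What remains is
   [A A^dag E + R_A E B^dag B], where [REL] reduces the second summand to [R_A E]. *)
move=> /mul_lp_eq0 REL.
rewrite !mulmxDr !mulmxDl mulmxN !mulmxA mulmx_lp mul0mx addr0 REL.
rewrite -[U3 *m _ *m _]mulmxA rp_mulmx mulmx0 addr0.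
rewrite addrACA addNr addr0 rpE mulmxBl mul1mx.
by rewrite addrC subrK.
Qed.

Lemma mulmx_pair_complete p q a b (A : 'M[quat R]_(p, a)) (B : 'M[quat R]_(b, q))
    (E : 'M[quat R]_(p, q)) (X : 'M_(a, q)) (Y : 'M_(p, b)) :
  A *m X + Y *m B = E ->
  rp A *m E *m lp B = 0 /\
  exists (U1 : 'M_(p, b)) (U2 : 'M_(a, q)) (U3 : 'M_(p, b)),
    X = A^dag *m E - A^dag *m U1 *m B + lp A *m U2 /\
    Y = rp A *m E *m B^dag + A *m A^dag *m U1 + U3 *m rp B.
Proof.
move=> <-; split.
  rewrite mulmxDr mulmxA rp_mulmx mul0mx add0r -!mulmxA mulmx_lp.
  by rewrite !mulmx0.
(* The solution serves as its own parameters: [L_A X] restores the part of [X] lost in [A^dag A X],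
   and [R_A Y R_B] the part of [Y] lost in [R_A Y B B^dag]. *)
exists Y, X, (rp A *m Y); split.
  by rewrite mulmxDr !mulmxA addrK lpE mulmxBl mul1mx addrC subrK.
rewrite mulmxDr mulmxA rp_mulmx mul0mx add0r [rp B]rpE mulmxBr mulmx1 !mulmxA.
by rewrite [RHS]addrC addrA subrK rpE mulmxBl mul1mx subrK.
Qed.

(** * The equation [A Y1 B + C Y2 D = E] *)

Section TwoTerm.
Context {p q a b c d : nat}.
Context (A : 'M[quat R]_(p, a)) (B : 'M[quat R]_(b, q))
        (C : 'M[quat R]_(p, c)) (D : 'M[quat R]_(d, q)).
Implicit Type E : 'M[quat R]_(p, q).

(** Variables with defining equations rather than definitions: both [M1], [N1], [S1] and [M], [N],
    [S] of the theorem can be plugged in, with [erefl] for the equations. *)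
Context (M : 'M[quat R]_(p, c)) (N : 'M[quat R]_(d, q)) (S : 'M[quat R]_(p, c)).
Hypotheses (ME : M = rp A *m C) (NE : N = D *m lp B) (SE : S = C *m lp M).

Definition two_term_Y1 E (U4 : 'M[quat R]_(c, d)) (U5 U6 : 'M[quat R]_(a, b)) :=
  A^dag *m E *m B^dag
  - A^dag *m C *m M^dag *m E *m B^dag
  - A^dag *m S *m C^dag *m E *m N^dag *m D *m B^dag
  - A^dag *m S *m U4 *m rp N *m D *m B^dag
  + lp A *m U5 + U6 *m rp B.

Definition two_term_Y2 E (U4 U7 U8 : 'M[quat R]_(c, d)) :=
  M^dag *m E *m D^dag
  + S^dag *m S *m C^dag *m E *m N^dag
  + lp M *m lp S *m U7 + U8 *m rp D + lp M *m U4 *m rp N.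

Definition two_term_cond E :=
  [/\ rp M *m rp A *m E = 0, E *m (lp B *m lp N) = 0,
      rp A *m E *m lp D = 0 & rp C *m E *m lp B = 0].

(** Each condition kills both summands: [R_M R_A] annihilates [A] and [C] from the left because
    [M = R_A C], dually [L_B L_N] annihilates [B] and [D] from the right, and the mixed pairs kill
    one summand on each side. *)
Lemma two_term_condP E Y1 Y2 :
  A *m Y1 *m B + C *m Y2 *m D = E -> two_term_cond E.
Proof.
have RC : rp M *m rp A *m C = 0 by rewrite -mulmxA -ME rp_mulmx.
have DL : D *m (lp B *m lp N) = 0 by rewrite mulmxA -NE mulmx_lp.
move=> <-; split; rewrite ?mulmxDr ?mulmxDl ?mulmxA.
- by rewrite RC -(mulmxA (rp M)) rp_mulmx mulmx0 !mul0mx addr0.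
- by rewrite (mulmx_eqA (mulmx_lp _)) mulmx0 mul0mx add0r -!mulmxA DL !mulmx0.
- by rewrite rp_mulmx !mul0mx add0r (mulmx_eqA (mulmx_lp _)) mulmx0.
- by rewrite rp_mulmx !mul0mx addr0 (mulmx_eqA (mulmx_lp _)) mulmx0.
Qed.

Let MR : M^dag *m rp A = M^dag.
Proof. by rewrite ME dag_mul_rp. Qed.
Let LN : lp B *m N^dag = N^dag.
Proof. by rewrite NE lp_mul_dag. Qed.
Let LS : lp M *m S^dag = S^dag.
Proof. by rewrite SE lp_mul_dag. Qed.
Let CSS : C *m S^dag *m S = S.
Proof. by rewrite -LS mulmxA -SE mulmx_dagK. Qed.
Let CLL : C *m lp M *m lp S = 0.
Proof. by rewrite -SE mulmx_lp. Qed.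
Let MdM : M^dag *m M = M^dag *m C.
Proof. by rewrite {2}ME mulmxA MR. Qed.

Let mulC_Y2 E U4 U7 U8 : C *m two_term_Y2 E U4 U7 U8 =
  C *m M^dag *m E *m D^dag + S *m C^dag *m E *m N^dag
  + C *m U8 *m rp D + S *m U4 *m rp N.
Proof.
by rewrite !mulmxDr !mulmxA CSS CLL mul0mx addr0 -SE.
Qed.

Let mulC_Y2_D E U4 U7 U8 : rp A *m E *m lp D = 0 ->
  C *m two_term_Y2 E U4 U7 U8 *m D =
  C *m M^dag *m E + S *m C^dag *m E *m N^dag *m D + S *m U4 *m rp N *m D.
Proof.
move=> /mul_lp_eq0 h; rewrite mulC_Y2 !mulmxDl (mulmx_eqA (rp_mulmx D)) mulmx0 addr0.
congr (_ + _ + _); rewrite -MR; move/(congr1 (mulmx (C *m M^dag))): h.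
by rewrite !mulmxA.
Qed.

(** The origin of the long formula for [Y1]: once [Y2] is chosen, [A Y1 B = E - C Y2 D] is solved
    for [Y1]. The parameters [U7], [U8] drop out because [C L_M L_S = 0] and [R_D D = 0]. *)
Lemma two_term_Y1E E U4 U5 U6 U7 U8 : rp A *m E *m lp D = 0 ->
  two_term_Y1 E U4 U5 U6 =
  A^dag *m (E - C *m two_term_Y2 E U4 U7 U8 *m D) *m B^dag
  + lp A *m U5 + U6 *m rp B.
Proof.
move=> /mulC_Y2_D ->; congr (_ + _ + _).
by rewrite mulmxBr mulmxBl !mulmxDr !mulmxDl !opprD !mulmxA !addrA.
Qed.

Lemma two_term_sound E U4 U5 U6 U7 U8 : two_term_cond E ->
  A *m two_term_Y1 E U4 U5 U6 *m B + C *m two_term_Y2 E U4 U7 U8 *m D = E.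
Proof.
case=> c1 c2 c3 c4; rewrite (two_term_Y1E _ _ _ U7 U8) //.
(* With [G = E - C Y2 D], the equation [A Y1 B = G] needs [R_A G = 0] and [G L_B = 0]. The first
   comes from [c1], as [R_A S = 0] and [M M^dag] fixes [R_A E]. *)
have h1 : rp A *m (E - C *m two_term_Y2 E U4 U7 U8 *m D) = 0.
  have RS : rp A *m S = 0 by rewrite SE mulmxA -ME mulmx_lp.
  rewrite mulC_Y2_D // mulmxBr !mulmxDr !mulmxA RS !mul0mx !addr0 -ME.
  rewrite -MR -!mulmxA (mulmxA M) rp_mul_eq0 ?subrr //.
  by rewrite mulmxA.
(* By [c2], [E N^dag N] is [E L_B]; by [c4], [C C^dag] fixes [E L_B]. Hence the [S] term contributes
   exactly what [C M^dag E L_B] lacks from [E L_B]. *)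
have h2 : (E - C *m two_term_Y2 E U4 U7 U8 *m D) *m lp B = 0.
  have ENN : E *m N^dag *m N = E *m lp B.
    rewrite -{1}LN mulmxA mul_lp_eq0 //.
    by rewrite -mulmxA.
  have CCE : C *m C^dag *m (E *m lp B) = E *m lp B.
    by apply: rp_mul_eq0; rewrite mulmxA.
  have SCE : S *m C^dag *m (E *m lp B) = E *m lp B - C *m M^dag *m (E *m lp B).
    rewrite SE [lp M]lpE mulmxBr mulmx1 !mulmxBl CCE MdM; congr (_ - _).
    by rewrite -[in RHS]CCE !mulmxA.
  rewrite mulC_Y2_D // mulmxBl !mulmxDl -!(mulmxA _ D) -NE.
  rewrite (mulmx_eqA (rp_mulmx N)) mulmx0 addr0.
  have -> : S *m C^dag *m E *m N^dag *m N = S *m C^dag *m (E *m lp B).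
    by rewrite -ENN !mulmxA.
  by rewrite SCE -(mulmxA _ E) [_ *m (E *m _) + _]addrC subrK subrr.
(* [G] is opaque: [mulmxDr] would expand its body. *)
have [G GE] : exists G, G = E - C *m two_term_Y2 E U4 U7 U8 *m D.
  by exists (E - C *m two_term_Y2 E U4 U7 U8 *m D).
rewrite -GE in h1 h2 *.
have -> : C *m two_term_Y2 E U4 U7 U8 *m D = E - G by rewrite GE subKr.
rewrite !mulmxDr !mulmxDl !mulmxA mulmx_lp !mul0mx addr0.
rewrite (mulmx_eqA (rp_mulmx B)) mulmx0 addr0.
by rewrite (rp_mul_eq0 h1) (mul_lp_eq0 h2) addrC subrK.
Qed.

(** Subtracting the particular solution with zero parameters leaves [Z] with [M Z D = 0] and
    [C Z N = 0], which splits into the homogeneous terms of [two_term_Y2]. Then [two_term_Y1E]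
    accounts for [Y1]. *)
Lemma two_term_complete E Y1 Y2 : A *m Y1 *m B + C *m Y2 *m D = E ->
  exists U4 U5 U6 U7 U8,
    Y1 = two_term_Y1 E U4 U5 U6 /\ Y2 = two_term_Y2 E U4 U7 U8.
Proof.
move=> h; have hE := two_term_condP h.
have [_ _ c3 _] := hE.
have := two_term_sound 0 0 0 0 0 hE.
move: (two_term_Y1 E 0 0 0) => y1.
have [y2 y2E] : exists y2, y2 = two_term_Y2 E 0 0 0 by exists (two_term_Y2 E 0 0 0).
have [Z ZE0] : exists Z, Z = Y2 - y2 by exists (Y2 - y2).
(* The factor [lp M] makes [lp M *m W = W] immediate; because [M Z D = 0], [W] equals
   [Z D D^dag]. *)
have [W WE0] : exists W, W = lp M *m Z *m D *m D^dag.
  by exists (lp M *m Z *m D *m D^dag).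
rewrite -y2E => h0.
have Zeq : A *m (Y1 - y1) *m B + C *m Z *m D = 0.
  by rewrite ZE0 !mulmxBr !mulmxBl addrACA -opprD h h0 subrr.
have MZD : M *m Z *m D = 0.
  move/(congr1 (mulmx (rp A))): Zeq.
  by rewrite mulmxDr !mulmxA rp_mulmx !mul0mx add0r mulmx0 -ME.
have CZN : C *m Z *m N = 0.
  move/(congr1 (fun X => X *m lp B)): Zeq.
  by rewrite mulmxDl mul0mx (mulmx_eqA (mulmx_lp B)) mulmx0 add0r NE mulmxA.
have SWN : S *m W *m N = 0.
  have DDN : D *m D^dag *m N = N by rewrite NE mulmxA mulmx_dagK.
  have SL : S *m lp M = S by rewrite SE -mulmxA lp_idem.
  have DDNA (X : 'M_(p, d)) : X *m D *m D^dag *m N = X *m N.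
    by rewrite -!mulmxA (mulmxA D) DDN.
  rewrite WE0 !mulmxA SL DDNA SE lpE mulmxBr mulmx1 !mulmxBl CZN sub0r NE.
  have -> : C *m (M^dag *m M) *m Z *m (D *m lp B)
          = C *m M^dag *m (M *m Z *m D) *m lp B.
    by rewrite !mulmxA.
  by rewrite MZD mulmx0 mul0mx oppr0.
(* [Z] is [Z R_D + W], and [W] is [L_M L_S W + S^dag S W]; the last piece may be flanked by [L_M]
   and [R_N] because [L_M S^dag = S^dag] and [S W N = 0]. *)
have ZE : Z = Z *m rp D + lp M *m lp S *m W
              + lp M *m (S^dag *m S *m W) *m rp N.
  have WE : W = Z *m D *m D^dag.
    rewrite WE0 [lp M]lpE mulmxBl mul1mx !mulmxBl.
    have -> : M^dag *m M *m Z *m D = M^dag *m (M *m Z *m D) by rewrite !mulmxA.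
    by rewrite MZD mulmx0 mul0mx subr0.
  have -> : lp M *m (S^dag *m S *m W) *m rp N = S^dag *m S *m W.
    have SSWN : S^dag *m S *m W *m N = 0.
      by rewrite -!mulmxA (mulmxA S) SWN mulmx0.
    by rewrite !mulmxA LS rpE mulmxBr mulmx1 !mulmxA SSWN mul0mx subr0.
  rewrite -addrA.
  have -> : lp M *m lp S *m W = W - S^dag *m S *m W.
    rewrite [lp S]lpE mulmxBr mulmx1 mulmxBl !mulmxA LS.
    by rewrite {1}WE0 !mulmxA lp_idem -WE0.
  by rewrite subrK WE rpE mulmxBr mulmx1 mulmxA subrK.
have Y2E : Y2 = two_term_Y2 E (S^dag *m S *m W) W Z.
  rewrite -[LHS](subrK y2) -ZE0 {1}ZE y2E.
  rewrite /two_term_Y2 !mulmx0 !mul0mx !addr0 addrC.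
  by rewrite -!addrA; congr (_ + (_ + _)); rewrite addrCA.
(* The formula for [Y1] becomes [A^dag A Y1 B B^dag + L_A Y1 + A^dag A Y1 R_B], which sums to
   [Y1]. *)
exists (S^dag *m S *m W), Y1, (A^dag *m A *m Y1), W, Z; split=> //.
rewrite (two_term_Y1E _ _ _ W Z) // -Y2E -h addrK !mulmxA.
rewrite [rp B]rpE mulmxBr mulmx1 !mulmxA.
by rewrite [RHS]addrC addrA subrK lpE mulmxBl mul1mx addrC subrK.
Qed.

(** Elimination yields the right side [R_C11 F L_D11], while [V3] and [W3] are written with [F].
    Every dagger adjacent to [E] absorbs [P] or [Q], since [P] also fixes [M] and [Q] also fixes
    [N]. *)
Lemma two_term_proj (P : 'M_p) (Q : 'M_q) E U4 U5 U6 U7 U8 :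
  ctrmx P = P -> ctrmx Q = Q -> P *m A = A -> P *m C = C ->
  B *m Q = B -> D *m Q = D ->
  two_term_Y1 (P *m E *m Q) U4 U5 U6 = two_term_Y1 E U4 U5 U6 /\
  two_term_Y2 (P *m E *m Q) U4 U7 U8 = two_term_Y2 E U4 U7 U8.
Proof.
move=> hP hQ PA PC BQ DQ.
have AP := dag_absorbl hP PA; have CP := dag_absorbl hP PC.
have QB := dag_absorbr hQ BQ; have QD := dag_absorbr hQ DQ.
have MP : M^dag *m P = M^dag.
  apply: dag_absorbl => //.
  by rewrite ME rpE mulmxBl mul1mx mulmxBr PC !mulmxA PA.
have QN : Q *m N^dag = N^dag.
  apply: dag_absorbr => //.
  by rewrite NE lpE mulmxBr mulmx1 mulmxBl DQ -!mulmxA BQ.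
by split; rewrite /two_term_Y1 /two_term_Y2 !mulmxA
  ?AP ?MP ?(mulmx_eqA CP) ?(mulmx_eqA MP) ?(mulmx_eqA QB) ?(mulmx_eqA QD)
  ?(mulmx_eqA QN).
Qed.

End TwoTerm.

(** * The equation [A1 X1 + X2 B1 + A2 Y1 B2 + A3 Y2 B3 = E] *)

Section FourTerm.
Context {p q a1 b1 a2 b2 a3 b3 : nat}.
Context (A1 : 'M[quat R]_(p, a1)) (B1 : 'M[quat R]_(b1, q))
        (A2 : 'M[quat R]_(p, a2)) (B2 : 'M[quat R]_(b2, q))
        (A3 : 'M[quat R]_(p, a3)) (B3 : 'M[quat R]_(b3, q))
        (E : 'M[quat R]_(p, q)).

(** For fixed [Y1], [Y2] this is the pair equation in the other two unknowns; the hypothesis is its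
    consistency condition. *)
Lemma four_term_sound (Y1 : 'M_(a2, b2)) (Y2 : 'M_(a3, b3))
    (U1 U3 : 'M_(p, b1)) (U2 : 'M_(a1, q)) :
  rp A1 *m A2 *m Y1 *m (B2 *m lp B1) + rp A1 *m A3 *m Y2 *m (B3 *m lp B1)
    = rp A1 *m E *m lp B1 ->
  A1 *m (A1^dag *m (E - A2 *m Y1 *m B2 - A3 *m Y2 *m B3)
         - A1^dag *m U1 *m B1 + lp A1 *m U2)
  + (rp A1 *m (E - A2 *m Y1 *m B2 - A3 *m Y2 *m B3) *m B1^dag
     + A1 *m A1^dag *m U1 + U3 *m rp B1) *m B1
  + A2 *m Y1 *m B2 + A3 *m Y2 *m B3 = E.
Proof.
move=> h; rewrite mulmx_pair_sound; first by rewrite [X in X + _]addrAC subrK subrK.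
by rewrite !mulmxBr !mulmxBl -h !mulmxA -addrA -opprD subrr.
Qed.

Lemma four_term_complete (X1 : 'M_(a1, q)) (X2 : 'M_(p, b1))
    (Y1 : 'M_(a2, b2)) (Y2 : 'M_(a3, b3)) :
  A1 *m X1 + X2 *m B1 + A2 *m Y1 *m B2 + A3 *m Y2 *m B3 = E ->
  rp A1 *m A2 *m Y1 *m (B2 *m lp B1) + rp A1 *m A3 *m Y2 *m (B3 *m lp B1)
    = rp A1 *m E *m lp B1 /\
  exists (U1 : 'M_(p, b1)) (U2 : 'M_(a1, q)) (U3 : 'M_(p, b1)),
    X1 = A1^dag *m (E - A2 *m Y1 *m B2 - A3 *m Y2 *m B3)
         - A1^dag *m U1 *m B1 + lp A1 *m U2 /\
    X2 = rp A1 *m (E - A2 *m Y1 *m B2 - A3 *m Y2 *m B3) *m B1^dag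
         + A1 *m A1^dag *m U1 + U3 *m rp B1.
Proof.
move=> h; have [|h0 ?] := @mulmx_pair_complete p q a1 b1 A1 B1
  (E - A2 *m Y1 *m B2 - A3 *m Y2 *m B3) X1 X2.
  by rewrite -h addrAC addrK addrK.
split=> //; apply/esym/eqP; rewrite -subr_eq0 opprD addrA.
by move: h0; rewrite !mulmxBr !mulmxBl !mulmxA => ->.
Qed.

End FourTerm.

(** * The system [A1 Y B1 = E1], [A2 Y B2 = E2] with nested coefficients *)

Section Nested.
Context {m n p1 q1 p2 q2 : nat}.
Context (A1 : 'M[quat R]_(p1, m)) (B1 : 'M[quat R]_(n, q1))
        (A2 : 'M[quat R]_(p2, m)) (B2 : 'M[quat R]_(n, q2))
        (E1 : 'M[quat R]_(p1, q1)) (E2 : 'M[quat R]_(p2, q2))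
        (K : 'M[quat R]_(p1, p2)) (J : 'M[quat R]_(q1, q2)).
Hypotheses (A1E : A1 = K *m A2) (B2E : B2 = B1 *m J).

Definition nested_sol (V1 V2 V3 : 'M[quat R]_(m, n)) :=
  A1^dag *m E1 *m B1^dag + lp A1 *m A2^dag *m E2 *m B2^dag
  + lp A2 *m V1 + V2 *m rp B1 + lp A1 *m V3 *m rp B2.

(** Accounts for the minus signs in [Y3W]. *)
Lemma nested_solN V1 V2 V3 : nested_sol (- V1) (- V2) (- V3) =
  A1^dag *m E1 *m B1^dag + lp A1 *m A2^dag *m E2 *m B2^dag
  - lp A2 *m V1 - V2 *m rp B1 - lp A1 *m V3 *m rp B2.
Proof. by rewrite /nested_sol !mulmxN !mulNmx. Qed.

Let AL : A1 *m lp A2 = 0.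
Proof. by rewrite A1E -mulmxA mulmx_lp mulmx0. Qed.
Let RB : rp B1 *m B2 = 0.
Proof. by rewrite B2E mulmxA rp_mulmx mul0mx. Qed.

(** Nesting gives [A1 A2^dag A2 = A1] and [B1 B1^dag B2 = B2]. In the second equation the first term
    therefore contributes [A2 A1^dag A1 Y B2], which the factor [L_A1] of the second term subtracts
    again. *)
Lemma nested_sound V1 V2 V3 :
  (exists Y, A1 *m Y *m B1 = E1 /\ A2 *m Y *m B2 = E2) ->
  A1 *m nested_sol V1 V2 V3 *m B1 = E1 /\ A2 *m nested_sol V1 V2 V3 *m B2 = E2.
Proof.
case=> Y [Y1 Y2]; rewrite /nested_sol !mulmxDr !mulmxDl !mulmxA.
rewrite AL !mulmx_lp !mul0mx !addr0.
rewrite !(mulmx_eqA (rp_mulmx _)) (mulmx_eqA RB) !mulmx0 !addr0.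
split.
  by rewrite -Y1 !mulmxA mulmx_dagK -!mulmxA (mulmxA B1) mulmx_dagK.
rewrite -Y1 -Y2.
have BBB : B1 *m B1^dag *m B2 = B2 by rewrite B2E mulmxA mulmx_dagK.
have A1A : A1 *m A2^dag *m A2 = A1 by rewrite A1E -!mulmxA (mulmxA A2) mulmx_dagK.
have -> : A2 *m A1^dag *m (A1 *m Y *m B1) *m B1^dag *m B2
        = A2 *m A1^dag *m A1 *m Y *m B2 by rewrite -[in RHS]BBB !mulmxA.
have -> : A2 *m lp A1 *m A2^dag *m (A2 *m Y *m B2) *m B2^dag *m B2
        = A2 *m lp A1 *m A2^dag *m A2 *m Y *m B2.
  by rewrite -!mulmxA (mulmxA B2) mulmx_dagK.
rewrite lpE mulmxBr mulmx1 !mulmxBl mulmx_dagK.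
have -> : A2 *m (A1^dag *m A1) *m A2^dag *m A2 = A2 *m A1^dag *m A1.
  by rewrite -[X in _ = _ *m X]A1A !mulmxA.
by rewrite addrC subrK.
Qed.

(** A homogeneous solution [Z] is [L_A2 Z + A2^dag A2 Z R_B1 + W] with [W = A2^dag A2 Z B1 B1^dag].
    By nesting [A1 W = 0] and [W B2 = 0], so [W = L_A1 W R_B2] has the shape of the last term. *)
Lemma nested_complete Y : A1 *m Y *m B1 = E1 -> A2 *m Y *m B2 = E2 ->
  exists V1 V2 V3, Y = nested_sol V1 V2 V3.
Proof.
move=> Y1 Y2.
have := nested_sound 0 0 0 (ex_intro _ Y (conj Y1 Y2)).
have [y yE] : exists y, y = nested_sol 0 0 0 by exists (nested_sol 0 0 0).
rewrite -yE => -[y1 y2].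
have [Z ZE] : exists Z, Z = Y - y by exists (Y - y).
have Z1 : A1 *m Z *m B1 = 0 by rewrite ZE mulmxBr mulmxBl Y1 y1 subrr.
have Z2 : A2 *m Z *m B2 = 0 by rewrite ZE mulmxBr mulmxBl Y2 y2 subrr.
have A1A : A1 *m A2^dag *m A2 = A1 by rewrite A1E -!mulmxA (mulmxA A2) mulmx_dagK.
have BBB : B1 *m B1^dag *m B2 = B2 by rewrite B2E mulmxA mulmx_dagK.
have [W WE] : exists W, W = A2^dag *m A2 *m Z *m B1 *m B1^dag.
  by exists (A2^dag *m A2 *m Z *m B1 *m B1^dag).
have A1W : A1 *m W = 0 by rewrite WE !mulmxA A1A Z1 mul0mx.
have WB2 : W *m B2 = 0.
  have -> : W *m B2 = A2^dag *m (A2 *m Z *m (B1 *m B1^dag *m B2)).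
    by rewrite WE !mulmxA.
  by rewrite BBB Z2 mulmx0.
have LWR : lp A1 *m W *m rp B2 = W.
  by rewrite lpE mulmxBl mul1mx -mulmxA A1W mulmx0 subr0 rpE mulmxBr mulmx1
     mulmxA WB2 mul0mx subr0.
exists Z, (A2^dag *m A2 *m Z), W.
have -> : nested_sol Z (A2^dag *m A2 *m Z) W
        = y + (lp A2 *m Z + A2^dag *m A2 *m Z *m rp B1 + W).
  by rewrite /nested_sol LWR yE /nested_sol !(mulmx0, mul0mx) !addr0 !addrA.
rewrite [in _ *m rp B1]rpE mulmxBr mulmx1 mulmxA -WE -!addrA addNr addr0.
by rewrite lpE mulmxBl mul1mx subrK ZE addrC subrK.
Qed.

End Nested.

End Projections.

(** * Block form of the equality between the two descriptions of [Y3] *)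

Lemma split_block_equation m n k l (P Q : 'M[quat R]_m) (G H : 'M[quat R]_n)
    (K : 'M[quat R]_(m, k)) (L : 'M[quat R]_(l, n))
    (K' : 'M[quat R]_(m, k)) (L' : 'M[quat R]_(l, n))
    (X : 'M[quat R]_(m + m, n)) (Y : 'M[quat R]_(m, n + n)) (v w : 'M[quat R]_(k, l))
    (f1 f2 : 'M[quat R]_(m, n)) :
  row_mx P Q *m X + Y *m col_mx G H + K *m v *m L + K' *m w *m L' = f2 - f1 <->
  f1 + P *m (row_mx 1%:M 0 *m X) + Y *m col_mx 1%:M 0 *m G + K *m v *m L
  = f2 - Q *m (row_mx 0 1%:M *m X) - Y *m col_mx 0 1%:M *m H - K' *m w *m L'.
Proof.
(* The identity blocks select the two halves of [X] and of [Y]; after that only summands have to be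
   moved across the equality. *)
have -> : row_mx P Q *m X
        = P *m (row_mx 1%:M 0 *m X) + Q *m (row_mx 0 1%:M *m X).
  rewrite !mulmxA -mulmxDl !mul_mx_row add_row_mx !mulmx0 !mulmx1.
  by rewrite addr0 add0r.
have -> : Y *m col_mx G H
        = Y *m col_mx 1%:M 0 *m G + Y *m col_mx 0 1%:M *m H.
  rewrite -!mulmxA -mulmxDr !mul_col_mx add_col_mx !mul0mx !mul1mx.
  by rewrite addr0 add0r.
move: (P *m _) (Q *m _) (_ *m G) (_ *m H) (_ *m L) (_ *m L') => x1 x2 y1 y2 z1 z2.
(* The summands [z2], [y2], [x2] come last, in the order in which [subr_eq] brings them over. *)
have E : x1 + x2 + (y1 + y2) + z1 + z2 + f1 = f1 + x1 + y1 + z1 + z2 + y2 + x2.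
  by rewrite !addrA (ACl (7*1*3*5*6*4*2)).
split=> h; apply/eqP.
  by rewrite eq_sym !subr_eq -E h subrK.
by rewrite eq_sym subr_eq E h !subrK.
Qed.

Lemma merge_block_equation m n k l (P Q : 'M[quat R]_m) (G H : 'M[quat R]_n)
    (K : 'M[quat R]_(m, k)) (L : 'M[quat R]_(l, n))
    (K' : 'M[quat R]_(m, k)) (L' : 'M[quat R]_(l, n))
    (v1 w1 v2 w2 f1 f2 : 'M[quat R]_(m, n)) (v3 w3 : 'M[quat R]_(k, l)) :
  f1 + P *m v1 + v2 *m G + K *m v3 *m L = f2 + Q *m w1 + w2 *m H + K' *m w3 *m L' ->
  row_mx P Q *m col_mx v1 (- w1) + row_mx v2 (- w2) *m col_mx G H
    + K *m v3 *m L + K' *m (- w3) *m L' = f2 - f1.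
Proof.
rewrite split_block_equation !mul_row_col !mul0mx !mulmx0 !mul1mx !mulmx1.
by rewrite !addr0 !add0r !mulmxN !mulNmx !opprK.
Qed.

(** * The five-term equation *)

Section Assembly.
Context {p q a1 b1 a2 b2 a3 b3 m n : nat}.
Context (A1 : 'M[quat R]_(p, a1)) (A2 : 'M[quat R]_(p, a2))
        (A3 : 'M[quat R]_(p, a3)) (A4 : 'M[quat R]_(p, m))
        (B1 : 'M[quat R]_(b1, q)) (B2 : 'M[quat R]_(b2, q))
        (B3 : 'M[quat R]_(b3, q)) (B4 : 'M[quat R]_(n, q))
        (B : 'M[quat R]_(p, q)).

Let lE k l (X : 'M[quat R]_(k, l)) : Lmx X = 1%:M - X^dag *m X.
Proof. by []. Qed.
Let rE k l (X : 'M[quat R]_(k, l)) : Rmx X = 1%:M - X *m X^dag.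
Proof. by []. Qed.

Local Notation A11 := (Sylv.A11 A1 A2).
Local Notation A22 := (Sylv.A22 A1 A3).
Local Notation B11 := (Sylv.B11 B1 B2).
Local Notation B22 := (Sylv.B22 B1 B3).
Local Notation M1 := (Sylv.M1 A1 A2 A3).
Local Notation N1 := (Sylv.N1 B1 B2 B3).
Local Notation C1 := (Sylv.C1 A1 A2 A3 A4).
Local Notation C2 := (Sylv.C2 A1 A2 A4).
Local Notation C3 := (Sylv.C3 A1 A3 A4).
Local Notation C4 := (Sylv.C4 A1 A4).
Local Notation D1 := (Sylv.D1 B1 B4).
Local Notation D2 := (Sylv.D2 B1 B3 B4).
Local Notation D3 := (Sylv.D3 B1 B2 B4).
Local Notation D4 := (Sylv.D4 B1 B2 B3 B4).
Local Notation E1 := (Sylv.E1 A1 A2 A3 B1 B).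
Local Notation E2 := (Sylv.E2 A1 A2 B1 B3 B).
Local Notation E3 := (Sylv.E3 A1 A3 B1 B2 B).
Local Notation E4 := (Sylv.E4 A1 B1 B2 B3 B).
Local Notation T := (Sylv.T A1 A4 B1 B4 B).
Local Notation C11 := (Sylv.C11 A1 A2 A4).
Local Notation D11 := (Sylv.D11 B1 B2 B4).
Local Notation C22 := (Sylv.C22 A1 A2 A3 A4).
Local Notation C33 := (Sylv.C33 A1 A3 A4).
Local Notation D22 := (Sylv.D22 B1 B3 B4).
Local Notation D33 := (Sylv.D33 B1 B2 B3 B4).
Local Notation E11 := (Sylv.E11 A1 A2 A3 A4).
Local Notation E22 := (Sylv.E22 A1 A2 A3 A4).
Local Notation E33 := (Sylv.E33 B1 B2 B3 B4).
Local Notation E44 := (Sylv.E44 B1 B2 B3 B4).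
Local Notation M := (Sylv.M A1 A2 A3 A4).
Local Notation N := (Sylv.N B1 B2 B3 B4).
Local Notation S := (Sylv.S A1 A2 A3 A4).
Local Notation F1 := (Sylv.F1 A1 A2 A3 A4 B1 B3 B4 B).
Local Notation F2 := (Sylv.F2 A1 A3 A4 B1 B2 B3 B4 B).
Local Notation F := (Sylv.F A1 A2 A3 A4 B1 B2 B3 B4 B).
Local Notation V3 := (Sylv.V3 A1 A2 A3 A4 B1 B2 B3 B4 B).
Local Notation W3 := (Sylv.W3 A1 A2 A3 A4 B1 B2 B3 B4 B).
Local Notation Y3V := (Sylv.Y3V A1 A2 A3 A4 B1 B2 B3 B4 B).
Local Notation Y3W := (Sylv.Y3W A1 A2 A3 A4 B1 B2 B3 B4 B).
Local Notation Y1 := (Sylv.Y1 A1 A2 A3 A4 B1 B2 B3 B4 B).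
Local Notation Y2 := (Sylv.Y2 A1 A2 A3 A4 B1 B2 B3 B4 B).
Local Notation solution := (Sylv.solution A1 A2 A3 A4 B1 B2 B3 B4 B).

(** The order 1, 4, 2, 3 follows that of [two_term_cond]. *)
Definition Y3_cond (Y : 'M[quat R]_(m, n)) :=
  [/\ C1 *m Y *m D1 = E1, C4 *m Y *m D4 = E4,
      C2 *m Y *m D2 = E2 & C3 *m Y *m D3 = E3].

(** This is the form in which the four-term lemmas produce the reduced right side once the [Y3] term
    has been moved over. *)
Lemma TE (Y : 'M[quat R]_(m, n)) :
  T Y = Rmx A1 *m (B - A4 *m Y *m B4) *m Lmx B1.
Proof.
rewrite /Sylv.T /Sylv.T1 /Sylv.A33 /Sylv.B33.
move: (Rmx A1) (Lmx B1) => P L.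
by rewrite mulmxBr mulmxBl !mulmxA.
Qed.

(** [T] is affine in [Y]; moving the [Y] part of each condition to the other side gives the
    corresponding [C_i Y D_i = E_i] up to unfolding. *)
Lemma two_term_cond_T (Y : 'M[quat R]_(m, n)) :
  two_term_cond (@Lmx R) (@Rmx R) A11 B11 A22 B22 M1 N1 (T Y) <-> Y3_cond Y.
Proof.
have eqL k (K : 'M_(k, p)) (t : 'M_(p, q)) (a : 'M_(p, m)) (b : 'M_(n, q)) :
    K *m (t - a *m Y *m b) = 0 <-> K *m a *m Y *m b = K *m t.
  rewrite mulmxBr !mulmxA; split=> [/eqP|->]; last by rewrite subrr.
  by rewrite subr_eq0 => /eqP.
have eqR k (J : 'M_(q, k)) (t : 'M_(p, q)) (a : 'M_(p, m)) (b : 'M_(n, q)) :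
    (t - a *m Y *m b) *m J = 0 <-> a *m Y *m (b *m J) = t *m J.
  rewrite mulmxBl !mulmxA; split=> [/eqP|->]; last by rewrite subrr.
  by rewrite subr_eq0 => /eqP.
have eqLR k l (K : 'M_(k, p)) (J : 'M_(q, l)) (t : 'M_(p, q)) (a : 'M_(p, m))
    (b : 'M_(n, q)) :
    K *m (t - a *m Y *m b) *m J = 0 <-> K *m a *m Y *m (b *m J) = K *m t *m J.
  rewrite mulmxBr mulmxBl !mulmxA; split=> [/eqP|->]; last by rewrite subrr.
  by rewrite subr_eq0 => /eqP.
split=> -[h1 h2 h3 h4]; split.
- exact/eqL.
- exact/eqR.
- exact/eqLR.
- exact/eqLR.
- exact/eqL.
- exact/eqR.
- exact/eqLR.
- exact/eqLR.
Qed.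

Lemma solution_Y3_cond X1 X2 y1 y2 y3 :
  solution X1 X2 y1 y2 y3 -> Y3_cond y3.
Proof.
move=> h; apply/two_term_cond_T; rewrite TE.
have h0 : A1 *m X1 + X2 *m B1 + A2 *m y1 *m B2 + A3 *m y2 *m B3
        = B - A4 *m y3 *m B4 by rewrite -h addrK.
have [h1 _] := four_term_complete lE rE h0.
exact: (two_term_condP lE rE (erefl _) (erefl _) h1).
Qed.

Lemma Y3_cond_VW y : Y3_cond y ->
  exists (X : 'M[quat R]_(m + m, n)) (Y : 'M[quat R]_(m, n + n))
         (v w : 'M[quat R]_(m, n)),
    C11 *m X + Y *m D11 + C22 *m v *m D22 + C33 *m w *m D33 = F /\
    y = F1 + Lmx C2 *m (row_mx 1%:M 0 *m X) + Y *m col_mx 1%:M 0 *m Rmx D1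
        + Lmx C1 *m v *m Rmx D2.
Proof.
move=> [h1 h4 h2 h3].
(* The other two nestings, [D2 = D1 L_B22] and [C3 = R_A22 C4], hold by definition. *)
have C1E : C1 = Rmx M1 *m C2 by rewrite mulmxA.
have D4E : D4 = D3 *m Lmx N1 by rewrite -mulmxA.
have [v1 [v2 [v3 yV]]] := nested_complete lE rE C1E (erefl D2) h1 h2.
have [w1 [w2 [w3 yW]]] := nested_complete lE rE (erefl C3) D4E h3 h4.
exists (col_mx v1 (- w1)), (row_mx v2 (- w2)), v3, (- w3).
split; first by apply: merge_block_equation; rewrite -[LHS]yV -[RHS]yW.
have -> : row_mx 1%:M 0 *m col_mx v1 (- w1) = v1.
  by rewrite mul_row_col mul1mx mul0mx addr0.
have -> : row_mx v2 (- w2) *m col_mx 1%:M 0 = v2.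
  by rewrite mul_row_col mulmx1 mulmx0 addr0.
exact: yV.
Qed.

(** [W3] subtracts its last term where [two_term_Y2] adds it, hence the sign of [U42] here and
    below. *)
Lemma W3E U31 U41 U42 : W3 U31 U41 U42 =
  two_term_Y2 (@Lmx R) (@Rmx R) E22 E44 M N S F U31 U41 (- U42).
Proof. by rewrite /two_term_Y2 mulNmx addrAC. Qed.

Lemma VW_proj U31 U32 U33 U41 U42 :
  two_term_Y1 (@Lmx R) (@Rmx R) E11 E33 E22 E44 M N S
    (Rmx C11 *m F *m Lmx D11) U31 U32 U33 = V3 U31 U32 U33 /\
  two_term_Y2 (@Lmx R) (@Rmx R) E22 E44 M N S
    (Rmx C11 *m F *m Lmx D11) U31 U41 U42 = W3 U31 U41 (- U42).
Proof.
have RR X : Rmx C11 *m (Rmx C11 *m X) = Rmx C11 *m X :> 'M_(m, m).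
  by rewrite mulmxA (rp_idem rE).
have LL X : X *m Lmx D11 *m Lmx D11 = X *m Lmx D11 :> 'M_(n, n).
  by rewrite -mulmxA (lp_idem lE).
have [h1 h2] := two_term_proj lE rE S (erefl M) (erefl N) F U31 U32 U33 U41 U42
  (ctrmx_rp rE C11) (ctrmx_lp lE D11) (RR C22) (RR C33) (LL D22) (LL D33).
by rewrite W3E opprK; split; [exact: h1|exact: h2].
Qed.

(** One [y] makes the block equation, and so its reduced two-term equation, consistent; hence
    arbitrary parameters solve it and both forms of [Y3] agree. The [V] form then yields equations 1
    and 2, the [W] form 3 and 4. *)
Lemma Y3V_sound U11 U12 U21 U31 U32 U33 U41 U42 : (exists y, Y3_cond y) ->
  Y3V U11 U12 U21 U31 U32 U33 U41 U42 = Y3W U11 U12 U21 U31 U32 U33 U41 U42 /\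
  Y3_cond (Y3V U11 U12 U21 U31 U32 U33 U41 U42).
Proof.
case=> y hy; have [X [Y [v [w [h _]]]]] := Y3_cond_VW hy.
have [h1 _] := four_term_complete lE rE h.
have h2 := two_term_condP lE rE (erefl _) (erefl _) h1.
have h3 := two_term_sound lE rE (erefl M) (erefl N) (erefl S)
  U31 U32 U33 U41 (- U42) h2.
have [e1 e2] := VW_proj U31 U32 U33 U41 (- U42).
rewrite e1 e2 opprK in h3.
have h4 := four_term_sound lE rE U11 U21 U12 h3.
have VWE : Y3V U11 U12 U21 U31 U32 U33 U41 U42 = Y3W U11 U12 U21 U31 U32 U33 U41 U42.
  exact: (proj1 (split_block_equation _ _ _ _ _ _ _ _ _ _ _ _ F1 F2) h4).
split; first exact: VWE.
case: hy => g1 g4 g2 g3.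
have C1E : C1 = Rmx M1 *m C2 by rewrite mulmxA.
have D4E : D4 = D3 *m Lmx N1 by rewrite -mulmxA.
have [k1 k2] := nested_sound lE rE C1E (erefl D2)
  (Sylv.V1 A1 A2 A3 A4 B1 B2 B3 B4 B U11 U12 U31 U32 U33 U41 U42)
  (Sylv.V2 A1 A2 A3 A4 B1 B2 B3 B4 B U11 U21 U31 U32 U33 U41 U42)
  (V3 U31 U32 U33)
  (ex_intro _ y (conj g1 g2)).
have [k3 k4] := nested_sound lE rE (erefl C3) D4E
  (- Sylv.W1 A1 A2 A3 A4 B1 B2 B3 B4 B U11 U12 U31 U32 U33 U41 U42)
  (- Sylv.W2 A1 A2 A3 A4 B1 B2 B3 B4 B U11 U21 U31 U32 U33 U41 U42)
  (- W3 U31 U41 U42)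
  (ex_intro _ y (conj g3 g4)).
rewrite nested_solN in k3 k4.
by split; [exact: k1|rewrite VWE; exact: k4|exact: k2|rewrite VWE; exact: k3].
Qed.

Lemma Y3V_complete y : Y3_cond y ->
  exists U11 U12 U21 U31 U32 U33 U41 U42,
    y = Y3V U11 U12 U21 U31 U32 U33 U41 U42.
Proof.
move=> hy; have [X [Y [v [w [h ->]]]]] := Y3_cond_VW hy.
have [h1 [U11 [U12 [U21 [-> ->]]]]] := four_term_complete lE rE h.
have [U31 [U32 [U33 [U41 [U42 [-> ->]]]]]] :=
  two_term_complete lE rE (erefl M) (erefl N) (erefl S) h1.
have [-> ->] := VW_proj U31 U32 U33 U41 U42.
by exists U11, U12, U21, U31, U32, U33, U41, (- U42).
Qed.

Let restE y1 y2 y3 :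
  B - A2 *m y1 *m B2 - A3 *m y2 *m B3 - A4 *m y3 *m B4
  = B - A4 *m y3 *m B4 - A2 *m y1 *m B2 - A3 *m y2 *m B3.
Proof.
move: (A2 *m _ *m _) (A3 *m _ *m _) (A4 *m _ *m _) => x y z.
by rewrite (addrAC _ (- y)) (addrAC B).
Qed.

Lemma tuple_sound y3 U1 U2 U3 U4 U5 U6 U7 U8 : Y3_cond y3 ->
  solution
    (Sylv.X1 A1 A2 A3 A4 B1 B2 B3 B4 B y3 U1 U2 U4 U5 U6 U7 U8)
    (Sylv.X2 A1 A2 A3 A4 B1 B2 B3 B4 B y3 U1 U3 U4 U5 U6 U7 U8)
    (Y1 y3 U4 U5 U6) (Y2 y3 U4 U7 U8) y3.
Proof.
move=> /two_term_cond_T h.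
have h1 := two_term_sound lE rE (erefl M1) (erefl N1) (erefl _) U4 U5 U6 U7 U8 h.
rewrite [RHS in _ = RHS]TE in h1.
have h2 := four_term_sound lE rE U1 U3 U2 h1.
rewrite /Sylv.solution /Sylv.X1 /Sylv.X2 !restE.
apply: etrans (congr1 (fun X => X + A4 *m y3 *m B4) h2) _.
exact: subrK.
Qed.

Lemma tuple_complete X1 X2 y1 y2 y3 : solution X1 X2 y1 y2 y3 ->
  exists U1 U2 U3 U4 U5 U6 U7 U8,
    Sylv.tuple_of A1 A2 A3 A4 B1 B2 B3 B4 B y3 U1 U2 U3 U4 U5 U6 U7 U8
      X1 X2 y1 y2 y3.
Proof.
move=> h.
have h0 : A1 *m X1 + X2 *m B1 + A2 *m y1 *m B2 + A3 *m y2 *m B3 = B - A4 *m y3 *m B4.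
  by rewrite -h addrK.
have [h1 [U1 [U2 [U3 [X1E X2E]]]]] := four_term_complete lE rE h0.
rewrite -TE in h1.
have [U4 [U5 [U6 [U7 [U8 [Y1E Y2E]]]]]] :=
  two_term_complete lE rE (erefl M1) (erefl N1) (erefl _) h1.
rewrite -restE Y1E Y2E in X1E X2E.
exists U1, U2, U3, U4, U5, U6, U7, U8.
by split; [exact: X1E|exact: X2E|exact: Y1E|exact: Y2E|].
Qed.

End Assembly.

End QuatMatrix.

Theorem theorem3p3 (R : realType) (p q a1 b1 a2 b2 a3 b3 m n : nat)
    (A1 : 'M[quat R]_(p, a1)) (A2 : 'M[quat R]_(p, a2))
    (A3 : 'M[quat R]_(p, a3)) (A4 : 'M[quat R]_(p, m))
    (B1 : 'M[quat R]_(b1, q)) (B2 : 'M[quat R]_(b2, q))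
    (B3 : 'M[quat R]_(b3, q)) (B4 : 'M[quat R]_(n, q))
    (B : 'M[quat R]_(p, q)) :
  (exists (X1 : 'M[quat R]_(a1, q)) (X2 : 'M[quat R]_(p, b1))
          (Y1 : 'M[quat R]_(a2, b2)) (Y2 : 'M[quat R]_(a3, b3))
          (Y3 : 'M[quat R]_(m, n)),
     Sylv.solution A1 A2 A3 A4 B1 B2 B3 B4 B X1 X2 Y1 Y2 Y3) ->
  (forall (U11 : 'M[quat R]_(m, n + n)) (U12 : 'M[quat R]_(m + m, n))
          (U21 : 'M[quat R]_(m, n + n))
          (U31 U32 U33 U41 U42 : 'M[quat R]_(m, n)),
     Sylv.Y3V A1 A2 A3 A4 B1 B2 B3 B4 B U11 U12 U21 U31 U32 U33 U41 U42
     = Sylv.Y3W A1 A2 A3 A4 B1 B2 B3 B4 B U11 U12 U21 U31 U32 U33 U41 U42)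
  /\
  (forall (X1 : 'M[quat R]_(a1, q)) (X2 : 'M[quat R]_(p, b1))
          (Y1 : 'M[quat R]_(a2, b2)) (Y2 : 'M[quat R]_(a3, b3))
          (Y3 : 'M[quat R]_(m, n)),
     Sylv.solution A1 A2 A3 A4 B1 B2 B3 B4 B X1 X2 Y1 Y2 Y3 <->
     exists (U1 : 'M[quat R]_(p, b1)) (U2 : 'M[quat R]_(a1, q))
            (U3 : 'M[quat R]_(p, b1)) (U4 : 'M[quat R]_(a3, b3))
            (U5 U6 : 'M[quat R]_(a2, b2)) (U7 U8 : 'M[quat R]_(a3, b3))
            (U11 : 'M[quat R]_(m, n + n)) (U12 : 'M[quat R]_(m + m, n))
            (U21 : 'M[quat R]_(m, n + n))
            (U31 U32 U33 U41 U42 : 'M[quat R]_(m, n)),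
       Sylv.tuple_of A1 A2 A3 A4 B1 B2 B3 B4 B
         (Sylv.Y3V A1 A2 A3 A4 B1 B2 B3 B4 B
            U11 U12 U21 U31 U32 U33 U41 U42)
         U1 U2 U3 U4 U5 U6 U7 U8 X1 X2 Y1 Y2 Y3).
Proof.
(* Of the given solution only [Y3_cond y3] is kept: it guarantees the consistency that [Y3V_sound]
   asks for. *)
case=> [x1 [x2 [y1 [y2 [y3 /solution_Y3_cond y3P]]]]].
split=> [U11 U12 U21 U31 U32 U33 U41 U42|X1 X2 Y1 Y2 Y3].
  by have [] := Y3V_sound U11 U12 U21 U31 U32 U33 U41 U42 (ex_intro _ y3 y3P).
split=> [h|].
  have [U1 [U2 [U3 [U4 [U5 [U6 [U7 [U8 hU]]]]]]]] := tuple_complete h.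
  have [U11 [U12 [U21 [U31 [U32 [U33 [U41 [U42 Y3E]]]]]]]] :=
    Y3V_complete (solution_Y3_cond h).
  exists U1, U2, U3, U4, U5, U6, U7, U8, U11, U12, U21, U31, U32, U33, U41, U42.
  by rewrite -Y3E.
move=> [U1 [U2 [U3 [U4 [U5 [U6 [U7 [U8]]]]]]]].
move=> [U11 [U12 [U21 [U31 [U32 [U33 [U41 [U42]]]]]]]].
case=> -> -> -> -> ->; apply: tuple_sound.
by have [] := Y3V_sound U11 U12 U21 U31 U32 U33 U41 U42 (ex_intro _ y3 y3P).
Qed.
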